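(* Let $n,k$ be positive integers and let $p$ be a prime. Then (a) $a_{1,k}(n)=c_{k+1}(n-k)$, and (b) $a_{p,k}(n)=\bar c_{k,p}(n-p-k+1)$.
   Context: A partition of $n$ is a weakly decreasing finite sequence of positive integers summing to $n$; $\mathcal P(n)$ is the set of partitions of $n$ (the empty partition is the unique partition of $0$, and there are no partitions of negative integers). For a partition $\lambda$ and positive integer $i$, $m_\lambda(i)$ is the number of parts of $\lambda$ equal to $i$. For a partition $\lambda=(\lambda_1,\ldots,\lambda_\ell)$ with $\ell\ge k$, $\mathrm{pre}_k(\lambda)$ is the partition whose parts are the $\binom{\ell}{k}$ products $\lambda_{i_1}\cdots\lambda_{i_k}$ over all $1\le i_1<\cdots<i_k\le\ell$ (with multiplicity); it is undefined if $\ell<k$. $\mathrm{pre}_k(\mathcal P(n))$ denotes the set of partitions $\mathrm{pre}_k(\lambda)$ for $\lambda\in\mathcal P(n)$ with at least $k$ parts, and $a_{i,k}(n)=\sum_{\nu\in \mathrm{pre}_k(\mathcal P(n))} m_\nu(i)$ is the total number of parts equal to $i$ among these partitions. $c_k(n)$ is the number of partitions of $n$ in which the part $1$ may occur in $k$ distinct colors and all other parts are uncolored (two such partitions are the same iff they have the same number of parts of each uncolored value and of each colored $1$). $\bar c_{k,p}(n)$ is the number of partitions of $n$ in which the part $1$ may occur in $k$ distinct colors, the part $p$ may occur in $2$ distinct colors, and all other parts are uncolored. Both counts are $0$ for negative $n$. *)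

(* Defs.v *)
From mathcomp Require Import all_boot all_order all_algebra.

Set Implicit Arguments.
Unset Strict Implicit.
Unset Printing Implicit Defensive.

Definition is_partition (n : nat) (s : seq nat) : bool :=
  [&& sorted geq s, all (leq 1) s & sumn s == n].

(* A partition of n has at most n parts, each at most n; [mem_partitions]
   shows that these bounds lose nothing. *)
Definition partitions (n : nat) : seq (seq nat) :=
  [seq [seq val x | x <- s]
     | s : n.-bseq 'I_n.+1
       in [pred s : n.-bseq 'I_n.+1 | is_partition n [seq val x | x <- s]]].

Lemma partitions_uniq n : uniq (partitions n).
Proof.
rewrite map_inj_uniq ?enum_uniq // => s t.
by move/(inj_map val_inj)/val_inj.
Qed.

Lemma mem_partitions n s : (s \in partitions n) = is_partition n s.
Proof.
apply/imageP/idP => [[t Pt ->] // | Ps].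
have [_ pos_s /eqP sum_s] := and3P Ps.
have le_size : size s <= n.
  rewrite -sum_s; elim: s pos_s {Ps sum_s} => //= x s IHs /andP[x_gt0 /IHs le_s].
  by rewrite -add1n leq_add.
have le_part : all (fun x => x < n.+1) s.
  apply/allP => x s_x; rewrite ltnS -sum_s.
  elim: s s_x {Ps pos_s sum_s le_size} => //= y s IHs.
  rewrite inE => /predU1P[-> | /IHs le_x]; first exact: leq_addr.
  exact: leq_trans le_x (leq_addl _ _).
pose t : seq 'I_n.+1 := [seq inord x | x <- s].
have le_t : size t <= n by rewrite size_map.
have val_t : [seq val x | x <- t] = s.
  by rewrite -map_comp map_id_in // => x /(allP le_part) lt_x; rewrite /= inordK.
by exists (Bseq le_t); rewrite /= ?inE /= val_t.
Qed.

Definition mult (s : seq nat) (i : nat) : nat := count_mem i s.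

(* Subsets are taken on positions, so equal products are kept with
   multiplicity; sorting makes equality of sequences equality of partitions.
   Meaningful only when k <= size s. *)
Definition pre (k : nat) (s : seq nat) : seq nat :=
  sort geq [seq \prod_(j in A) nth 0 s j
              | A : {set 'I_(size s)} in [pred A : {set _} | #|A| == k]].

(* [undup]: pre_k is not injective in general (for instance (6,6,1) and (9,2,2)
   have the same image under pre_3), and the image is taken as a set. *)
Definition pre_partitions (k n : nat) : seq (seq nat) :=
  undup [seq pre k s | s <- partitions n & k <= size s].

Definition a_ (i k n : nat) : nat :=
  \sum_(nu <- pre_partitions k n) mult nu i.

(* Number of partitions of n in which the part i comes in [ncol i] colors.
   Such a partition is given by its multiplicities: an index [Tagged _ c] with
   tag i stands for the part i.+1 in color c, and since all parts are positive
   both the part sizes and the multiplicities are at most n. *)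
Definition colored_partitions (ncol : nat -> nat) (n : int) : nat :=
  match n with
  | Posz n =>
      #|[set m : {ffun {i : 'I_n & 'I_(ncol i.+1)} -> 'I_n.+1} |
          \sum_(x : {i : 'I_n & 'I_(ncol i.+1)}) (tag x).+1 * m x == n]|
  | Negz _ => 0
  end.

Definition c_ (k : nat) (n : int) : nat :=
  colored_partitions (fun i => if i == 1 then k else 1) n.

Definition cbar_ (k p : nat) (n : int) : nat :=
  colored_partitions
    (fun i => if i == 1 then k else if i == p then 2 else 1) n.

(* Main.v *)
(* For s a partition with m ones, let N(k, v) be the number of k-subsets of its
   parts with product v.  Then N(k, 1) = C(m, k), and for v > 1,
     N(k+1, v) = m_s(v) C(m, k) + (a term depending only on the parts < v),
   the last term being 0 when v is prime.  If C(m, k) > 0, this triangular system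
   recovers s from pre_(k+1)(s); as N(k+1, 1) and N(k+1, p) vanish otherwise,
   taking the image as a set loses nothing, and
     a_1(n) = sum_s C(m, k+1)   and   a_p(n) = sum_s m_s(p) C(m, k).
   The identity sum_j C(j, r) x^(dj) = x^(dr) / (1 - x^d)^(r+1) then shows that
   weighting each s by prod_i C(m_s(i), r_i) amounts to lowering n by
   sum_i i r_i and giving r_i + 1 colors to the part i. *)
Require Import Defs.
From mathcomp Require Import all_boot all_order all_algebra.
From mathcomp Require Import zify ring.

Set Implicit Arguments.
Unset Strict Implicit.
Unset Printing Implicit Defensive.

Import GRing.Theory.

(** * Counting subsets of parts by their product *)

(** This is N(k, v), for [v > 0] and positive parts, written as a recursion on whether the first
    part is chosen, so that its properties follow by induction on [s] rather than from sums over
    sets of positions. *)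
Fixpoint num_subset_products (s : seq nat) (k v : nat) : nat :=
  match s, k with
  | _, 0 => v == 1
  | [::], _.+1 => 0
  | x :: s', k'.+1 =>
      num_subset_products s' k v + (x %| v) * num_subset_products s' k' (v %/ x)
  end.

Lemma num_subset_products0 s v : num_subset_products s 0 v = (v == 1).
Proof. by case: s. Qed.

Lemma num_subset_products_small s k v : size s < k -> num_subset_products s k v = 0.
Proof.
elim: s k v => [|x s IHs] [|k] v //= lt_sk.
by rewrite !IHs ?muln0 // ltnW.
Qed.

(** The two sums collect the sets without and with [ord0]; they will match the two branches of
    [num_subset_products]. *)
Lemma big_set_recl (n : nat) (F : {set 'I_n.+1} -> nat) :
  \sum_A F A = \sum_(A : {set 'I_n}) F [set lift ord0 i | i in A]
             + \sum_(A : {set 'I_n}) F (ord0 |: [set lift ord0 i | i in A]).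
Proof.
have liftK (A : {set 'I_n}) : lift ord0 @^-1: (lift ord0 @: A) = A.
  by apply/setP=> i; rewrite inE mem_imset //; apply: lift_inj.
have lift0 (A : {set 'I_n}) : ord0 \in [set lift ord0 i | i in A] = false.
  by apply/imsetP=> -[i _ /eqP]; rewrite (negPf (neq_lift _ _)).
have memlift (A : {set 'I_n}) i :
    (lift ord0 i \in [set lift ord0 i | i in A]) = (i \in A).
  by rewrite mem_imset //; apply: lift_inj.
rewrite (bigID [pred A : {set 'I_n.+1} | ord0 \notin A]) /=; congr (_ + _).
  rewrite (reindex_onto (fun A : {set 'I_n} => lift ord0 @: A)
    (fun B : {set 'I_n.+1} => lift ord0 @^-1: B)) /=.
    by apply: eq_bigl => A; rewrite liftK eqxx lift0.
  move=> B B0; apply/setP=> i; case: (unliftP ord0 i) => [j|] ->.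
    by rewrite memlift inE.
  by rewrite lift0 (negPf B0).
rewrite (reindex_onto (fun A : {set 'I_n} => ord0 |: lift ord0 @: A)
  (fun B : {set 'I_n.+1} => lift ord0 @^-1: B)) /=.
  apply: eq_bigl => A; rewrite negbK setU11 /=; apply/eqP/setP => i.
  by rewrite !inE memlift eq_sym (negPf (neq_lift _ _)).
move=> B; rewrite negbK => B0; apply/setP=> i; case: (unliftP ord0 i) => [j|] ->.
  by rewrite !inE memlift inE eq_sym (negPf (neq_lift _ _)).
by rewrite setU11 B0.
Qed.

Lemma sum_num_subset_products s k v : 0 < v -> all (leq 1) s ->
  \sum_(A : {set 'I_(size s)})
     ((#|A| == k) && (\prod_(j in A) nth 0 s j == v)) = num_subset_products s k v.
Proof.
elim: s k v => [|x s IHs] k v v_gt0 /= => [_|/andP[x_gt0 s_gt0]].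
  have all0 (A : {set 'I_0}) : A = set0 by apply/setP => -[].
  rewrite (bigD1 set0) //= [X in _ + X]big1 ?addn0 => [|A]; last by rewrite [A]all0 eqxx.
  by rewrite cards0 big_set0; case: k => [|k] //=; rewrite eq_sym.
have card_lift (A : {set 'I_(size s)}) : #|[set lift ord0 i | i in A]| = #|A|.
  by rewrite card_imset //; apply: lift_inj.
have lift0 (A : {set 'I_(size s)}) : ord0 \in [set lift ord0 i | i in A] = false.
  by apply/imsetP=> -[i _ /eqP]; rewrite (negPf (neq_lift _ _)).
have prod_lift (A : {set 'I_(size s)}) :
    \prod_(j in [set lift ord0 i | i in A]) nth 0 (x :: s) j
    = \prod_(j in A) nth 0 s j.
  by rewrite big_imset //= => i j _ _; apply: lift_inj.
have consE : \sum_(A : {set 'I_(size s).+1})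
      ((#|A| == k) && (\prod_(j in A) nth 0 (x :: s) j == v))
    = num_subset_products s k v
      + \sum_(A : {set 'I_(size s)})
          ((#|A|.+1 == k) && (x * \prod_(j in A) nth 0 s j == v)).
  rewrite big_set_recl; congr (_ + _).
    by rewrite -(IHs k v) //; apply: eq_bigr => A _; rewrite card_lift prod_lift.
  apply: eq_bigr => A _; rewrite cardsU1 lift0 card_lift add1n.
  by rewrite big_setU1 ?lift0 //= prod_lift.
rewrite consE; case: k {consE} => [|k] /=.
  by rewrite num_subset_products0 big1 ?addn0.
congr (_ + _); have [x_dv | x_ndv] := boolP (x %| v); last first.
  apply: big1 => A _; rewrite andbC; case: eqP => //= def_v.
  by rewrite -def_v dvdn_mulr in x_ndv.
rewrite mul1n -IHs ?divn_gt0 ?(dvdn_leq v_gt0) //.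
by apply: eq_bigr => A _; rewrite eqSS -{1}(divnK x_dv) mulnC eqn_pmul2r.
Qed.

Lemma mult_pre s k v : 0 < v -> all (leq 1) s ->
  mult (pre k s) v = num_subset_products s k v.
Proof.
move=> v_gt0 s_gt0; rewrite /mult /pre.
rewrite (permP (permEl (perm_sort _ _))) count_map -sum_num_subset_products //.
rewrite -sum1_count big_enum_cond big_mkcond /=; apply: eq_bigr => A _.
by rewrite !inE /=; case: (_ && _).
Qed.

(** Only parts equal to 1 can be chosen, and on them the recursion is Pascal's rule. *)
Lemma num_subset_products_one s k : all (leq 1) s ->
  num_subset_products s k 1 = 'C(mult s 1, k).
Proof.
elim: s k => [|x s IHs] [|k] //= => [_|/andP[x_gt0 s_gt0]]; first by rewrite bin0.
rewrite dvdn1 !IHs // /mult /=; case: eqP => [-> | _].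
  by rewrite divn1 IHs // mul1n add1n binS.
by rewrite mul0n addn0.
Qed.

(** A part at least [b] exceeds [v > 0], hence does not divide it and is never chosen. *)
Lemma num_subset_products_filter s k v b : 0 < v < b ->
  num_subset_products s k v = num_subset_products [seq x <- s | x < b] k v.
Proof.
elim: s k v => [|x s IHs] [|k] v v_lt_b //=; first by rewrite num_subset_products0.
have [v_gt0 lt_vb] := andP v_lt_b.
case: ltnP => [lt_xb | le_bx] /=.
  rewrite -IHs //; congr (_ + _); have [x_dv | ] := boolP (x %| v) => //.
  rewrite -IHs // divn_gt0 ?(dvdn_leq v_gt0 x_dv) ?(dvdn_gt0 v_gt0 x_dv) //=.
  exact: leq_ltn_trans (leq_div _ _) lt_vb.
by rewrite gtnNdvd ?addn0 ?IHs // (leq_trans lt_vb).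
Qed.

(* A [k.+1]-subset with product [v] either contains a part [v], and then all
   its other parts are 1, or uses only parts smaller than [v]. *)
Lemma num_subset_productsS s k v : 1 < v -> all (leq 1) s ->
  num_subset_products s k.+1 v =
  mult s v * 'C(mult s 1, k) + num_subset_products [seq x <- s | x < v] k.+1 v.
Proof.
move=> v_gt1; have v_gt0 := ltnW v_gt1; rewrite /mult.
elim: s k => [|x s IHs] k //= /andP[x_gt0 s_gt0]; rewrite IHs //.
have [lt_vx | lt_xv | def_x] := ltngtP v x; last first.
- rewrite -def_x dvdnn divnn v_gt0 num_subset_products_one // /mult.
  by rewrite (gtn_eqF v_gt1) add0n mul1n mulSn addnAC [X in X + _]addnC.
(* If 1 < x < v, the quotient v / x is below v, so subsets using x avoid all parts >= v. If x = 1,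
   the target stays v and Pascal's rule combines the induction hypotheses for two consecutive sizes;
   [k = 0] is apart because the hypothesis only covers nonempty subsets. *)
- rewrite add0n /= -addnA; case: eqP => [-> | x_neq1] /=; last first.
    rewrite add0n; congr (_ + (_ + _)); have [x_dv | ] := boolP (x %| v) => //.
    congr (_ * _); apply: num_subset_products_filter.
    by rewrite divn_gt0 // (dvdn_leq v_gt0) //= ltn_Pdiv //; lia.
  rewrite dvd1n divn1 !mul1n; case: k => [|k].
    by rewrite !num_subset_products0 !bin0.
  by rewrite IHs // add1n binS mulnDr !addnA [X in X + _ = _]addnAC.
rewrite gtnNdvd // mul0n addn0 (gtn_eqF (ltn_trans v_gt1 lt_vx)).
by rewrite !add0n.
Qed.

(** A part below [p] dividing [p] is 1, so choosing it leaves the target [p], which the empty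
    product never reaches. *)
Lemma num_subset_products_lt_prime p s k : prime p -> all (fun x => x < p) s ->
  num_subset_products s k p = 0.
Proof.
move=> p_pr; have p_gt1 := prime_gt1 p_pr.
elim: s k => [|x s IHs] [|k] //=; rewrite ?(gtn_eqF p_gt1) // => /andP[lt_xp s_lt].
rewrite IHs //; have [x_dv | //] := boolP (x %| p).
have /primeP[_ /(_ x x_dv)] := p_pr; rewrite (ltn_eqF lt_xp) orbF => /eqP->.
by rewrite divn1 IHs.
Qed.

Lemma num_subset_products_prime p s k : prime p -> all (leq 1) s ->
  num_subset_products s k.+1 p = mult s p * 'C(mult s 1, k).
Proof.
move=> p_pr s_gt0; rewrite num_subset_productsS ?prime_gt1 //.
by rewrite num_subset_products_lt_prime ?addn0 ?filter_all.
Qed.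

(** * Recovering a partition from its image *)

Lemma geq_trans : transitive geq.
Proof. by move=> x y z; rewrite /geq => ? /leq_trans; apply. Qed.

Lemma mult_inj s t : sorted geq s -> sorted geq t ->
  mult s =1 mult t -> s = t.
Proof.
move=> s_sorted t_sorted eq_st; apply: (sorted_eq geq_trans) => //.
  by move=> x y; rewrite /geq => /andP[/= ? ?]; lia.
by apply/allP => v _; apply/eqP/eq_st.
Qed.

(** By Pascal's rule C(m+1, k+1) exceeds C(m, k+1) by C(m, k), which stays positive once it is. *)
Lemma bin_inj_ge k m1 m2 : 0 < 'C(m1, k) -> 0 < 'C(m2, k) ->
  'C(m1, k.+1) = 'C(m2, k.+1) -> m1 = m2.
Proof.
have bin_lt m d : 0 < 'C(m, k) -> 'C(m, k.+1) < 'C(m + d.+1, k.+1).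
  move=> C_gt0; elim: d => [|d IHd]; first by rewrite addn1 binS; lia.
  by rewrite addnS binS (leq_trans IHd) ?leq_addr.
wlog le_m : m1 m2 / m1 <= m2 => [IH | C1 C2 eqC].
  by case/orP: (leq_total m1 m2) => /IH // IHm ? ? ?; apply/esym/IHm.
have /subnKC := le_m; case: (m2 - m1) => [|d] def_m; first lia.
by have := bin_lt m1 d C1; rewrite def_m eqC ltnn.
Qed.

Lemma pre_inj k s t :
    sorted geq s -> all (leq 1) s -> sorted geq t -> all (leq 1) t ->
    0 < 'C(mult s 1, k) -> 0 < 'C(mult t 1, k) ->
  pre k.+1 s = pre k.+1 t -> s = t.
Proof.
move=> s_sorted s_gt0 t_sorted t_gt0 Cs_gt0 Ct_gt0 eq_pre.
have eq_prod v : 0 < v -> num_subset_products s k.+1 v = num_subset_products t k.+1 v.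
  by move=> v_gt0; rewrite -!mult_pre // eq_pre.
have eq1 : mult s 1 = mult t 1.
  by apply: (bin_inj_ge Cs_gt0 Ct_gt0); rewrite -!num_subset_products_one ?eq_prod.
apply: mult_inj => // v; elim/ltn_ind: v => v IHv.
have mult0 r : all (leq 1) r -> mult r 0 = 0.
  by move=> r_gt0; apply/count_memPn/negP => /(allP r_gt0).
have [v_gt1 | ] := ltnP 1 v; last first.
  by case: v {IHv} => [|[|//]] _; rewrite ?mult0.
(* By induction the parts below [v] agree, so the last term of [num_subset_productsS] is common to
   both sides and cancels; the factor 'C(mult s 1, k) > 0 then cancels too. *)
have eq_filter : [seq x <- s | x < v] = [seq x <- t | x < v].
  apply: mult_inj; rewrite ?(sorted_filter geq_trans) // => w; rewrite /mult !count_filter.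
  have count_lt r : count (predI (pred1 w) (fun x => x < v)) r = (w < v) * mult r w.
    rewrite /mult; case: ltnP => [lt_wv | le_vw].
      by rewrite mul1n; apply: eq_count => x /=; case: eqP => // ->.
    rewrite mul0n -(count_pred0 r); apply: eq_count => x /=.
    by case: eqP => // ->; rewrite ltnNge le_vw.
  by rewrite !count_lt; case: ltnP => // /IHv ->.
have := eq_prod v (ltnW v_gt1).
rewrite (num_subset_productsS _ v_gt1 s_gt0) (num_subset_productsS _ v_gt1 t_gt0).
rewrite eq_filter eq1 => /eqP.
by rewrite eqn_add2r eqn_pmul2r // => /eqP.
Qed.

(** * From the set of images to a sum over partitions *)

Lemma sum_undup_map (T U : eqType) (f : T -> U) (F : U -> nat) (s : seq T) :
    uniq s ->
    {in s &, forall x y, F (f x) != 0 -> f x = f y -> x = y} ->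
  \sum_(u <- undup (map f s)) F u = \sum_(x <- s) F (f x).
Proof.
move=> s_uniq f_inj.
have nz (V : eqType) (G : V -> nat) r : \sum_(u <- r) G u = \sum_(u <- r | G u != 0) G u.
  by rewrite [RHS]big_mkcond; apply: eq_bigr => u _; case: eqP.
rewrite nz [RHS]nz -big_filter filter_undup filter_map undup_id ?big_map ?big_filter //.
rewrite map_inj_in_uniq ?filter_uniq // => x y; rewrite !mem_filter /=.
by move=> /andP[nz_x s_x] /andP[_ s_y]; apply: f_inj.
Qed.

Lemma a_sum_partitions i k n : 0 < i ->
    (forall s, all (leq 1) s -> num_subset_products s k.+1 i != 0 ->
       0 < 'C(mult s 1, k)) ->
  a_ i k.+1 n = \sum_(s <- partitions n) num_subset_products s k.+1 i.
Proof.
move=> i_gt0 C_gt0; rewrite /a_ sum_undup_map; last first.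
- move=> s t; rewrite !mem_filter !mem_partitions.
  move=> /andP[_ /and3P[s_sorted s_gt0 _]] /andP[_ /and3P[t_sorted t_gt0 _]].
  move=> nz_s eq_st; have nz_t := nz_s; rewrite eq_st in nz_t.
  by apply: pre_inj eq_st => //; apply: C_gt0; rewrite -?mult_pre.
- by rewrite filter_uniq ?partitions_uniq.
(* Partitions with at most [k] parts have no image, but also no [k.+1]-subset, so they add 0 on the
   right. *)
rewrite big_filter [RHS](bigID (fun s => k < size s)) /= [X in _ = _ + X]big1 ?addn0.
  rewrite big_seq_cond [RHS]big_seq_cond; apply: eq_bigr => s.
  by rewrite mem_partitions => /andP[/and3P[_ s_gt0 _] _]; apply: mult_pre.
by move=> s; rewrite -leqNgt => ?; apply: num_subset_products_small.
Qed.

(** * Partitions as multiplicity functions *)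

Lemma sumn_mult s M : all (fun x => 0 < x <= M) s ->
  sumn s = \sum_(i < M) i.+1 * mult s i.+1.
Proof.
elim: s => [|x s IHs] /=; first by rewrite big1 // => i _; rewrite muln0.
case/andP=> /andP[x_gt0 le_xM] /IHs ->.
have lt_xM : x.-1 < M by rewrite prednK.
under [RHS]eq_bigr => i _ do rewrite mulnDr.
rewrite [RHS]big_split /=; congr (_ + _); rewrite (bigD1 (Ordinal lt_xM)) //=.
rewrite prednK // eqxx muln1 big1 ?addn0 // => i /eqP ne_ix.
case: eqP => [def_x | _]; last by rewrite muln0.
by case: ne_ix; apply: val_inj; rewrite /= def_x.
Qed.

Lemma size_le_sumn s : all (leq 1) s -> size s <= sumn s.
Proof. by elim: s => //= x s IHs /andP[x_gt0 /IHs]; rewrite -add1n; apply: leq_add. Qed.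

Lemma all_partition_le n s : is_partition n s -> all (fun x => 0 < x <= n) s.
Proof.
case/and3P=> _ s_gt0 /eqP <-; apply/allP=> x s_x.
rewrite (allP s_gt0 x s_x) /=; elim: s s_x {s_gt0} => //= y s IHs.
rewrite inE => /predU1P[-> | /IHs]; first exact: leq_addr.
by move/leq_trans; apply; apply: leq_addl.
Qed.

Lemma mult_flatten_nseq M (f : 'I_M -> nat) (i : 'I_M) :
  mult (flatten [seq nseq (f j) j.+1 | j <- enum 'I_M]) i.+1 = f i.
Proof.
rewrite /mult count_flatten -map_comp sumnE big_map big_enum /=.
rewrite (bigD1 i) //= count_nseq /= eqxx mul1n big1 ?addn0 // => j ne_ji.
by rewrite count_nseq /= eqSS (inj_eq val_inj) (negPf ne_ji).
Qed.

(** [M] may exceed [n], so that a prescribed part larger than [n] can still be indexed. *)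
Lemma big_partitions n M (F : ('I_M -> nat) -> nat) : n <= M ->
    (forall f g, f =1 g -> F f = F g) ->
  \sum_(s <- partitions n) F (fun i => mult s i.+1)
  = \sum_(f : {ffun 'I_M -> 'I_M.+1} | \sum_(i < M) i.+1 * f i == n)
      F (fun i : 'I_M => f i : nat).
Proof.
move=> le_nM F_ext.
pose mults s : {ffun 'I_M -> 'I_M.+1} := [ffun i : 'I_M => inord (mult s i.+1)].
have multsE s (i : 'I_M) : is_partition n s -> mults s i = mult s i.+1 :> nat.
  move=> Ps; rewrite ffunE inordK // ltnS; apply: leq_trans le_nM.
  have /and3P[_ s_gt0 /eqP <-] := Ps.
  by apply: leq_trans (size_le_sumn s_gt0); apply: count_size.
have partM s : is_partition n s -> all (fun x => 0 < x <= M) s.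
  move/all_partition_le; apply: sub_all => x /andP[-> le_xn].
  exact: leq_trans le_nM.
transitivity (\sum_(f <- [seq mults s | s <- partitions n])
                F (fun i : 'I_M => f i : nat)).
  rewrite big_map big_seq [RHS]big_seq; apply: eq_bigr => s.
  by rewrite mem_partitions => Ps; apply: F_ext => i; rewrite multsE.
rewrite -[RHS]big_filter; apply: perm_big; apply: uniq_perm.
- rewrite map_inj_in_uniq ?partitions_uniq // => s t.
  rewrite !mem_partitions => Ps Pt eq_st.
  have [[s_sorted _ _] [t_sorted _ _]] := (and3P Ps, and3P Pt).
  apply: mult_inj => // v; have [/andP[v_gt0 le_vM] | v_out] := boolP (0 < v <= M).
    have lt_vM : v.-1 < M by rewrite prednK.
    by rewrite -(prednK v_gt0) -(multsE s (Ordinal lt_vM)) // eq_st multsE.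
  have mult0 r : is_partition n r -> mult r v = 0.
    move/partM=> r_M; apply/count_memPn; apply: contra v_out.
    exact: (allP r_M).
  by rewrite !mult0.
- by rewrite filter_uniq ?index_enum_uniq.
move=> f; rewrite mem_filter mem_index_enum andbT; apply/mapP/idP => [[s] | /eqP sum_f].
  rewrite mem_partitions => Ps ->; have /and3P[_ _ /eqP <-] := Ps.
  rewrite (sumn_mult (partM s Ps)); apply/eqP; apply: eq_bigr => i _.
  by rewrite multsE.
(* Inverse map: take [f j] copies of each part [j.+1], then sort. *)
pose r := flatten [seq nseq (f j) j.+1 | j <- enum 'I_M].
have mult_r (i : 'I_M) : mult (sort geq r) i.+1 = f i.
  by rewrite -[RHS](mult_flatten_nseq (fun j => f j)); apply/permP/permEl/perm_sort.
have r_M : all (fun x => 0 < x <= M) (sort geq r).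
  rewrite all_sort; apply/allP => x /flatten_mapP[j _].
  by rewrite mem_nseq => /andP[_ /eqP ->] /=.
have Pr : is_partition n (sort geq r).
  apply/and3P; split.
  - by apply: sort_sorted => x y; apply: leq_total.
  - by apply: sub_all r_M => x /andP[].
  rewrite (sumn_mult r_M) -sum_f; apply/eqP.
  by apply: eq_bigr => i _; rewrite mult_r.
exists (sort geq r); first by rewrite mem_partitions.
by apply/ffunP => i; apply: val_inj; rewrite /= multsE // mult_r.
Qed.

(** * Truncated generating functions *)

Local Open Scope ring_scope.

(* Power series are handled as polynomials modulo 'X^n.+1. *)
Definition eq_upto (n : nat) (P Q : {poly int}) :=
  forall j, (j <= n)%N -> P`_j = Q`_j.

Lemma eq_upto_trans n P Q R : eq_upto n P Q -> eq_upto n Q R -> eq_upto n P R.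
Proof. by move=> eqPQ eqQR j le_jn; rewrite eqPQ ?eqQR. Qed.

Lemma eq_upto_mul n P P' Q Q' :
  eq_upto n P P' -> eq_upto n Q Q' -> eq_upto n (P * Q) (P' * Q').
Proof.
move=> eqP eqQ j le_jn; rewrite !coefM; apply: eq_bigr => i _.
have le_ij : (i <= j)%N by rewrite -ltnS.
by rewrite eqP ?eqQ // ?(leq_trans _ le_jn) // leq_subr.
Qed.

Lemma eq_upto_prod n (I : Type) (r : seq I) (P Q : I -> {poly int}) :
    (forall i, eq_upto n (P i) (Q i)) ->
  eq_upto n (\prod_(i <- r) P i) (\prod_(i <- r) Q i).
Proof.
by move=> eqPQ; apply: (big_ind2 (eq_upto n)) => // *; apply: eq_upto_mul.
Qed.

Lemma eq_upto_exp n P Q m : eq_upto n P Q -> eq_upto n (P ^+ m) (Q ^+ m).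
Proof.
by move=> eqPQ; elim: m => // m IHm; rewrite !exprS; apply: eq_upto_mul.
Qed.

(** Distributing the product chooses an exponent [f x] in each factor. The weight [u] will be 1 for
    colored partitions and a binomial coefficient for weighted ones. *)
Lemma coef_prod_sum (R : comNzRingType) (J : finType) (wt : J -> nat)
    (u : J -> nat -> nat) (B N : nat) :
  (\prod_x \sum_(j < B) ('X^(wt x * j) *+ u x j : {poly R}))`_N
  = (\sum_(f : {ffun J -> 'I_B} | \sum_x wt x * f x == N) \prod_x u x (f x))%N%:R.
Proof.
rewrite bigA_distr_bigA /= coef_sum natr_sum [RHS]big_mkcond.
apply: eq_bigr => f _ /=.
by rewrite prodrMn -expr_sum coefMn coefXn eq_sym; case: eqP; rewrite ?mul0rn.
Qed.

(** For [d > 0], agrees with 1 / (1 - X^d) up to degree [M]. *)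
Definition geom (d M : nat) : {poly int} := \sum_(j < M.+1) 'X^(d * j).

Lemma coef_geom d M j : (0 < d)%N -> (j <= M)%N -> (geom d M)`_j = (d %| j)%:R.
Proof.
move=> d_gt0 le_jM; rewrite /geom coef_sum.
have lt_jM : (j %/ d < M.+1)%N by rewrite ltnS (leq_trans (leq_div _ _)).
rewrite (bigD1 (Ordinal lt_jM)) //= coefXn big1 ?addr0.
  by rewrite mulnC eq_sym -dvdn_eq.
move=> i /eqP ne_i; rewrite coefXn; case: eqP => // def_j; case: ne_i.
by apply: val_inj; rewrite /= def_j mulKn.
Qed.

Definition bin_poly (r d M : nat) : {poly int} :=
  \sum_(j < M.+1) 'X^(d * j) *+ 'C(j, r).

(** Pascal's rule on coefficients, the shift from j to j+1 being multiplication by X^d; the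
    subtracted term is the overflow at j = M+1. *)
Lemma bin_polyS r d M :
  bin_poly r.+1 d M =
  'X^d * (bin_poly r.+1 d M + bin_poly r d M) - 'X^(d * M.+1) *+ 'C(M.+1, r.+1).
Proof.
apply/(canRL (addrK _)).
transitivity (\sum_(j < M.+2) 'X^(d * j) *+ 'C(j, r.+1) : {poly int}).
  by rewrite [RHS]big_ord_recr.
rewrite big_ord_recl bin0n mulr0n add0r /bin_poly -big_split mulr_sumr /=.
by apply: eq_bigr => j _; rewrite binS mulnS exprD mulrnDr mulrDr !mulrnAr.
Qed.

Lemma geom_inv d M : (1 - 'X^d) * geom d M = 1 - 'X^(d * M.+1).
Proof.
rewrite /geom exprM -[RHS]opprB subrX1 -mulNr opprB; congr (_ * _).
by apply: eq_bigr => j _; rewrite exprM.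
Qed.

Lemma eq_upto_subXn n m P Q : (n < m)%N -> eq_upto n (P - Q * 'X^m) P.
Proof.
by move=> lt_nm j le_jn; rewrite coefB coefMXn (leq_ltn_trans le_jn) ?subr0.
Qed.

(** Induction on [r]: up to degree [M], [bin_polyS] says that 1 - X^d times [bin_poly r.+1 d M] is
    X^d times [bin_poly r d M], and [geom d M] inverts 1 - X^d. *)
Lemma bin_poly_geom r d M : (0 < d)%N ->
  eq_upto M (bin_poly r d M) ('X^(d * r) * geom d M ^+ r.+1).
Proof.
move=> d_gt0; have lt_M : (M < d * M.+1)%N by rewrite leq_pmull.
elim: r => [|r IHr].
  have -> : bin_poly 0 d M = geom d M.
    by apply: eq_bigr => j _; rewrite bin0.
  by rewrite muln0 mul1r.
have step : eq_upto M (bin_poly r.+1 d M) ('X^d * geom d M * bin_poly r d M).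
  apply: (@eq_upto_trans _ _ (bin_poly r.+1 d M * ((1 - 'X^d) * geom d M))).
    move=> j le_j; rewrite geom_inv mulrBr mulr1.
    by rewrite (eq_upto_subXn _ _ lt_M).
  rewrite mulrA mulrBr mulr1 {1}bin_polyS.
  have -> : 'X^d * (bin_poly r.+1 d M + bin_poly r d M)
     - 'X^(d * M.+1) *+ 'C(M.+1, r.+1) - bin_poly r.+1 d M * 'X^d
     = 'X^d * bin_poly r d M - ('C(M.+1, r.+1)%:R) * 'X^(d * M.+1) :> {poly int}.
    by rewrite mulr_natl; ring.
  rewrite mulrAC; apply: eq_upto_mul => //; exact: eq_upto_subXn.
apply: eq_upto_trans step _.
rewrite mulnS exprD [geom d M ^+ _]exprS mulrACA.
exact: eq_upto_mul.
Qed.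

Lemma colored_partitionsE ncol N M : (N <= M)%N ->
  (colored_partitions ncol N%:Z)%:Z
  = (\prod_(0 <= i < M) geom i.+1 M ^+ ncol i.+1)`_N.
Proof.
move=> le_NM.
pose J : finType := {i : 'I_N & 'I_(ncol i.+1)}; pose wt (x : J) := (tag x).+1.
have -> : colored_partitions ncol N%:Z
    = (\sum_(m : {ffun J -> 'I_N.+1} | \sum_x wt x * m x == N) \prod_(x : J) 1)%N.
  rewrite /colored_partitions -sum1_card; apply: eq_big => m; first by rewrite inE.
  by rewrite big1_eq.
rewrite -natz -(coef_prod_sum int wt (fun _ _ => 1%N)).
have -> : \prod_x \sum_(j < N.+1) 'X^(wt x * j) *+ 1
    = \prod_(0 <= i < N) geom i.+1 N ^+ ncol i.+1 :> {poly int}.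
  rewrite big_mkord (eq_bigr (fun x => geom (wt x) N)) //.
  (* Group by part size: all colors of a part contribute the same factor. *)
  rewrite -(@sig_big_dep _ _ _ _ (fun i : 'I_N => 'I_(ncol i.+1)) predT (fun _ => predT)
             (fun i _ => geom i.+1 N)) /=.
  by apply: eq_bigr => i _; rewrite prodr_const card_ord.
(* For i < N, truncating at [N] or at [M] gives the same coefficients up to degree [N]; for i >= N,
   the factor is 1 up to degree [N], as its next exponent i+1 exceeds [N]. *)
rewrite [in RHS](@big_cat_nat _ _ _ N) //=.
rewrite -[\prod_(_ <= i < _) geom i.+1 N ^+ _]mulr1.
apply: (@eq_upto_mul N) => //.
  apply: eq_upto_prod => i; apply: eq_upto_exp => j le_jN.
  by rewrite !coef_geom // (leq_trans le_jN).
rewrite big_nat; apply: (big_ind (eq_upto N 1)) => //.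
  by move=> P Q eqP eqQ; rewrite -[1]mulr1; apply: eq_upto_mul.
move=> i /andP[le_Ni _]; rewrite -(expr1n _ (ncol i.+1)); apply: eq_upto_exp => j le_jN.
rewrite coef_geom ?(leq_trans le_jN) // coef1.
case: j le_jN => [|j] le_jN; first by rewrite dvdn0.
by rewrite gtnNdvd // ltnS (leq_trans le_jN).
Qed.

Lemma sum_prod_bin n M (r ncol : nat -> nat) : (n <= M)%N ->
    (forall i, ncol i.+1 = (r i.+1).+1) ->
  (\sum_(s <- partitions n) \prod_(i < M) 'C(mult s i.+1, r i.+1))%N
  = colored_partitions ncol (n%:Z - (\sum_(i < M) i.+1 * r i.+1)%N%:Z).
Proof.
move=> le_nM ncolE; set D := (\sum_(i < M) _)%N.
apply/eqP; rewrite -eqz_nat; apply/eqP.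
rewrite (@big_partitions n M (fun f => \prod_i 'C(f i, r i.+1))%N) //; last first.
  by move=> f g eq_fg; apply: eq_bigr => i _; rewrite eq_fg.
rewrite -natz -(coef_prod_sum int (fun i : 'I_M => i.+1) (fun i m => 'C(m, r i.+1))).
transitivity (('X^D * \prod_(i < M) geom i.+1 M ^+ ncol i.+1)`_n).
  rewrite /D expr_sum -big_split /=; apply: (@eq_upto_prod M) => // i.
  by rewrite ncolE; apply: bin_poly_geom.
(* If n < D the coefficient is 0, as is the count at a negative integer. *)
rewrite coefXnM; have [lt_nD | le_Dn] := ltnP n D.
  by have -> : n%:Z - D%:Z = Negz (D - n).-1 by lia.
rewrite subzn // (@colored_partitionsE _ _ M) ?(leq_trans (leq_subr _ _)) //.
by rewrite big_mkord.
Qed.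

(* The two identities *)
Local Close Scope ring_scope.

Theorem theorem3p1 (n k p : nat) (n_gt0 : 0 < n) (k_gt0 : 0 < k)
    (p_prime : prime p) :
  a_ 1 k n = c_ k.+1 (n%:Z - k%:Z)%R /\
  a_ p k n = cbar_ k p (n%:Z - p%:Z - k%:Z + 1)%R.
Proof.
(* From here on [k] is one less than in the statement. *)
case: k k_gt0 => // k _.
have p_gt1 := prime_gt1 p_prime; have p_gt0 := prime_gt0 p_prime.
split.
  rewrite a_sum_partitions // => [|s s_gt0]; last first.
    by rewrite num_subset_products_one // -lt0n !bin_gt0; apply: ltnW.
  (* Encodes the weight C(m, k+1), m being the number of ones: [n] drops by k+1 and the part 1 gets
     k+2 colors. *)
  pose r i := if i == 1 then k.+1 else 0.
  have sum_r : \sum_(i < n) i.+1 * r i.+1 = k.+1.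
    rewrite (bigD1 (Ordinal n_gt0)) //= big1 ?addn0 ?mul1n // => i.
    by rewrite -val_eqE /r eqSS => /negPf -> /=; rewrite muln0.
  rewrite /c_ -[X in (_ - X%:Z)%R]sum_r -sum_prod_bin // => [|i]; last first.
    by rewrite /r; case: eqP.
  rewrite big_seq [RHS]big_seq; apply: eq_bigr => s.
  rewrite mem_partitions => /and3P[_ s_gt0 _].
  rewrite num_subset_products_one // (bigD1 (Ordinal n_gt0)) //= big1 ?muln1 // => i.
  by rewrite -val_eqE /r eqSS => /negPf -> /=; rewrite bin0.
rewrite a_sum_partitions // => [|s s_gt0]; last first.
  by rewrite num_subset_products_prime // -lt0n muln_gt0 => /andP[].
(* Encodes the weight C(m, k) times the multiplicity of [p], read as a binomial with lower index 1.
   The bound [n + p] below keeps [p] in range even when p > n. *)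
pose r i := if i == 1 then k else (i == p : nat).
have lt0M : 0 < n + p by rewrite addn_gt0 n_gt0.
have ltpM : p.-1 < n + p by rewrite prednK // leq_addl.
have ne_p : Ordinal ltpM != Ordinal lt0M.
  by rewrite -val_eqE /= -lt0n -ltnS prednK.
have r_out (i : 'I_(n + p)) : i != Ordinal lt0M -> i != Ordinal ltpM -> r i.+1 = 0.
  rewrite -!val_eqE /= /r eqSS => /negPf -> /negPf ne_ip.
  by have -> : (i.+1 == p) = false by lia.
have r_p : r p = 1 by rewrite /r (gtn_eqF p_gt1) eqxx.
have sum_r : \sum_(i < n + p) i.+1 * r i.+1 = k + p.
  rewrite (bigD1 (Ordinal lt0M)) //= mul1n (bigD1 (Ordinal ltpM)) //=.
  rewrite prednK // r_p muln1 big1 ?addn0 // => i /andP[ne_i0 ne_ip].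
  by rewrite r_out ?muln0.
have -> : (n%:Z - p%:Z - k.+1%:Z + 1 = n%:Z - (k + p)%N%:Z)%R by lia.
rewrite /cbar_ -sum_r -sum_prod_bin ?leq_addr // => [|i]; last first.
  by rewrite /r; case: eqP => // _; case: eqP.
rewrite big_seq [RHS]big_seq; apply: eq_bigr => s.
rewrite mem_partitions => /and3P[_ s_gt0 _].
rewrite num_subset_products_prime // (bigD1 (Ordinal lt0M)) //= (bigD1 (Ordinal ltpM)) //=.
rewrite prednK // r_p bin1 big1 ?muln1 => [|i /andP[ne_i0 ne_ip]].
  by rewrite mulnC.
by rewrite r_out ?bin0.
Qed.
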